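(* If $G$ is a finite simple graph with $\chi(G)>\frac{|G|+3-\alpha(G)}{2}$, then $\chi(G)\le\left\lceil\frac{\omega(G)+\Delta(G)+1}{2}\right\rceil$.
   Context: $\chi(G)$, $\omega(G)$, $\Delta(G)$, $\alpha(G)$ and $|G|$ denote the chromatic number, clique number, maximum degree, independence number and number of vertices of $G$. *)

(* Defs.v *)
From mathcomp Require Import all_boot all_order all_algebra.

Set Implicit Arguments.
Unset Strict Implicit.
Unset Printing Implicit Defensive.

Record sgraph := SGraph {
  vertex :> finType;
  adj : rel vertex;
  adj_sym : symmetric adj;
  adj_irr : irreflexive adj }.

Section GraphParameters.
Variable G : sgraph.
Implicit Types (A : {set G}) (x y : G) (k : nat).

Definition colorable k : bool :=
  [exists c : {ffun G -> 'I_k}, [forall x, forall y, adj x y ==> (c x != c y)]].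

Lemma colorable_exists : exists k, colorable k.
Proof.
exists #|G|; apply/existsP; exists [ffun x => enum_rank x].
apply/forallP=> x; apply/forallP=> y; apply/implyP=> xy.
rewrite !ffunE (inj_eq enum_rank_inj).
by apply: contraTneq xy => ->; rewrite adj_irr.
Qed.

Definition chromatic_number : nat := ex_minn colorable_exists.

Definition clique A : bool :=
  [forall x in A, forall y in A, (x != y) ==> adj x y].

Definition independent A : bool :=
  [forall x in A, forall y in A, ~~ adj x y].

Definition clique_number : nat := \max_(A : {set G} | clique A) #|A|.

Definition independence_number : nat := \max_(A : {set G} | independent A) #|A|.

Definition degree x : nat := #|[set y | adj x y]|.

Definition max_degree : nat := \max_(x : G) degree x.

End GraphParameters.

(* Main.v *)
(* Deleting a maximum independent set I lowers chi by at most 1 and Delta by at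
   least 1, so it suffices to prove 2 chi <= omega + Delta + 1 for the graphs with
   2 chi >= n + 2.  A vertex-critical graph of this kind is a join B + C (Gallai),
   and 2 chi <= omega + n holds for every graph.  If 2 chi >= n + 2 in one of B, C,
   combine induction on that side with 2 chi <= omega + n on the other.  Otherwise
   2 chi = n + 1 in both: either C is a single vertex, or omega(C) >= 2 and it is
   enough to have 2 chi <= omega + Delta + 2 in B, which follows by deleting a
   maximum independent set if alpha(B) >= 3, and from the fact that non-neighbours
   of a vertex form a clique if alpha(B) <= 2. *)
Require Import Defs.
From mathcomp Require Import all_boot all_order all_algebra zify lra.
Import Order.TTheory GRing.Theory Num.Theory.

Set Implicit Arguments.
Unset Strict Implicit.
Unset Printing Implicit Defensive.

Section Coloring.
Variable G : sgraph.
Implicit Types (A B C I K : {set G}) (x y v w a : G) (T : finType).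

(** * Colourings of vertex subsets and the chromatic number they induce *)

Definition proper_on T A (c : G -> T) : bool :=
  [forall x in A, forall y in A, adj x y ==> (c x != c y)].

Definition singletons T A (c : G -> T) : {set G} :=
  [set x in A | [forall y in A, (c y == c x) ==> (y == x)]].

Lemma proper_onP T A (c : G -> T) :
  reflect {in A &, forall x y, adj x y -> c x != c y} (proper_on A c).
Proof.
apply: (iffP forall_inP) => [h x y xA yA|h x xA].
  by move/forall_inP: (h x xA) => /(_ y yA) /implyP.
by apply/forall_inP => y yA; apply/implyP; apply: h.
Qed.

Lemma singletonsP T A (c : G -> T) x :
  reflect (x \in A /\ {in A, forall y, c y = c x -> y = x})
          (x \in singletons A c).
Proof.
rewrite inE; apply: (iffP andP) => -[xA h]; split => //.
  move=> y yA /eqP cyx; apply/eqP.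
  by move/forall_inP: h => /(_ y yA) /implyP; apply.
by apply/forall_inP => y yA; apply/implyP => /eqP /(h y yA) ->.
Qed.

Lemma singletonsPn T A (c : G -> T) x : x \in A -> x \notin singletons A c ->
  exists2 y, y \in A & c y = c x /\ y != x.
Proof.
move=> xA; rewrite inE xA => /forall_inPn[y yA].
by rewrite negb_imply => /andP[/eqP cyx nyx]; exists y.
Qed.

Lemma proper_on_id A : proper_on A (finfun id : {ffun G -> G}).
Proof.
apply/proper_onP => x y _ _; rewrite !ffunE.
by apply: contraTneq => ->; rewrite adj_irr.
Qed.

(* Colours are taken in [G] itself, so that colourings form a finite type that does not depend on the number of colours. *)
Definition chi A : nat :=
  #|[arg min_(c < finfun id : {ffun G -> G} | proper_on A c) #|c @: A|] @: A|.

Lemma chiP A : exists2 c : {ffun G -> G}, proper_on A c & #|c @: A| = chi A.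
Proof.
rewrite /chi; case: arg_minnP; first exact: proper_on_id.
by move=> c cA _; exists c.
Qed.

(** Moves a colouring with any colour type into [G], the colour type over which [chi] minimises:
    each class met by [A] is named by one of its members in [A]. *)
Definition canonical T A (c : G -> T) : {ffun G -> G} :=
  [ffun x => odflt x [pick y in A | c y == c x]].

Lemma canonical_col T A (c : G -> T) x : c (canonical A c x) = c x.
Proof. by rewrite ffunE; case: pickP => [y /andP[_ /eqP]|]. Qed.

Lemma canonical_eq T A (c : G -> T) : {in A &, forall x y,
  (canonical A c x == canonical A c y) = (c x == c y)}.
Proof.
move=> x y xA yA; apply/eqP/eqP => [e|e].
  by rewrite -(canonical_col A c x) e canonical_col.
rewrite !ffunE e; case: pickP => [//|/(_ y)].
by rewrite yA eqxx.
Qed.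

Lemma proper_canonical T A (c : G -> T) :
  proper_on A c -> proper_on A (canonical A c).
Proof.
move=> /proper_onP cA; apply/proper_onP => x y xA yA xy.
by rewrite canonical_eq //; apply: cA.
Qed.

Lemma card_canonical T A (c : G -> T) : #|canonical A c @: A| = #|c @: A|.
Proof.
have -> : c @: A = c @: (canonical A c @: A).
  by rewrite -imset_comp; apply: eq_imset => x /=; rewrite canonical_col.
rewrite [in RHS]card_in_imset // => _ _ /imsetP[x xA ->] /imsetP[y yA ->].
by rewrite !canonical_col => e; apply/eqP; rewrite canonical_eq // e.
Qed.

Lemma chi_le T A (c : G -> T) : proper_on A c -> chi A <= #|c @: A|.
Proof.
move=> cA; rewrite -card_canonical /chi; case: arg_minnP; first exact: proper_on_id.
by move=> d _; apply; apply: proper_canonical.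
Qed.

Lemma chiU B C : chi (B :|: C) <= chi B + chi C.
Proof.
have [b /proper_onP bB <-] := chiP B; have [c /proper_onP cC <-] := chiP C.
pose d x : G + G := if x \in B then inl (b x) else inr (c x).
apply: leq_trans (chi_le (c := d) _) _.
  apply/proper_onP => x y; rewrite !inE /d.
  by case xB: (x \in B) => /=; case yB: (y \in B) => //= xC yC xy;
    rewrite (inj_eq (@inl_inj _ _), inj_eq (@inr_inj _ _)); [apply: bB|apply: cC].
rewrite -(card_imset (b @: B) (@inl_inj _ G)) -(card_imset (c @: C) (@inr_inj G _)).
apply: leq_trans (leq_card_setU _ _); apply/subset_leq_card/subsetP => t.
case/imsetP => x + ->; rewrite !inE /d; case: (boolP (x \in B)) => /= [xB _|_ xC].
  by rewrite !imset_f.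
by rewrite orbC !imset_f.
Qed.

Lemma chi0 : chi set0 = 0.
Proof. by have [c _ <-] := chiP set0; rewrite imset0 cards0. Qed.

Lemma independentP A : reflect {in A &, forall x y, ~~ adj x y} (independent A).
Proof.
apply: (iffP forall_inP) => [h x y xA yA|h x xA].
  by move/forall_inP: (h x xA) => /(_ y yA).
by apply/forall_inP => y yA; apply: h.
Qed.

Lemma cliqueP A :
  reflect {in A &, forall x y, x != y -> adj x y} (clique A).
Proof.
apply: (iffP forall_inP) => [h x y xA yA|h x xA].
  by move/forall_inP: (h x xA) => /(_ y yA) /implyP.
by apply/forall_inP => y yA; apply/implyP; apply: h.
Qed.

Lemma chi_independent A : independent A -> chi A <= 1.
Proof.
move=> /independentP iA; apply: leq_trans (chi_le (c := fun=> tt) _) _.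
  by apply/proper_onP => x y xA yA; rewrite (negbTE (iA _ _ _ _)).
by rewrite (leq_trans (max_card _)) // card_unit.
Qed.

(** * Singleton classes of optimal colourings, and Gallai's join decomposition *)

(** Two non-adjacent singleton classes could be merged, which would save a colour. *)
Lemma singletons_adj T A (c : G -> T) : proper_on A c -> #|c @: A| <= chi A ->
  {in singletons A c &, forall x y, x != y -> adj x y}.
Proof.
move=> /proper_onP cA cchi x y /singletonsP[xA sx] /singletonsP[yA sy] nxy.
apply/negPn/negP => nadj.
pose d v := if v == x then c y else c v.
have dA : proper_on A d.
  apply/proper_onP => u v uA vA uv; rewrite /d.
  case: (eqVneq u x) uv => [->|nux] uv; case: (eqVneq v x) uv => [->|nvx] uv.
  - by rewrite adj_irr in uv.
  - by apply: contraNneq nadj => /esym /(sy v vA) <-.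
  - by apply: contraNneq nadj => /(sy u uA) <-; rewrite adj_sym.
  - exact: cA.
have /chi_le := dA; rewrite leqNgt => /negP; apply; apply: leq_trans cchi.
apply/proper_card/properP; split.
  by apply/subsetP => _ /imsetP[v vA ->]; rewrite /d; case: ifP => _; apply: imset_f.
exists (c x); first exact: imset_f.
apply/imsetP => -[v vA]; rewrite /d; case: eqVneq => [_ e|nvx e].
  by rewrite (sy x xA e) eqxx in nxy.
by rewrite (sx v vA) ?eqxx in nvx.
Qed.

(** Every class other than a singleton contains at least two vertices. *)
Lemma card_singletons T A (c : G -> T) :
  #|c @: A|.*2 <= #|A| + #|singletons A c|.
Proof.
have -> : #|singletons A c| = \sum_(x in A) (x \in singletons A c).
  rewrite -big_mkcondr -sum1_card; apply: eq_bigl => x.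
  by rewrite inE; case: (x \in A).
rewrite -[#|A|]sum1_card -big_split /=.
rewrite (partition_big_imset c) /= -muln2 -sum_nat_const.
apply: leq_sum => _ /imsetP[x xA ->].
rewrite (bigD1 x) /= ?xA ?eqxx //.
case: (boolP (x \in singletons A c)) => // /(singletonsPn xA)[y yA [cy nyx]].
by rewrite (bigD1 y) /= ?yA ?cy ?eqxx ?nyx //; lia.
Qed.

(* Given a colouring [Q] with singleton class [{a}], any other singleton [{w}] of [Q] that is not a singleton of [P] can be enlarged to the whole [P]-class of [w]; this strictly enlarges the set of pairs that are monochromatic for both [P] and [Q]. *)
Lemma transfer_singletons A (P : {ffun G -> G}) a :
  proper_on A P -> a \in A -> chi (A :\ a) < chi A ->
  exists Q : {ffun G -> G}, [/\ proper_on A Q, #|Q @: A| <= chi A,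
    a \in singletons A Q & singletons A Q \subset a |: singletons A P].
Proof.
move=> /proper_onP PA aA crit.
pose good (Q : {ffun G -> G}) :=
  [&& proper_on A Q, #|Q @: A| <= chi A & a \in singletons A Q].
pose mono (Q : {ffun G -> G}) := [set p : G * G |
  [&& p.1 \in A, p.2 \in A, P p.1 == P p.2 & Q p.1 == Q p.2]].
have [Q0 gQ0] : exists Q, good Q.
  have [c /proper_onP cA cchi] := chiP (A :\ a).
  (* An optimal colouring of [A :\ a] plus the fresh colour [None] on [a]; by [crit] this uses at
     most [chi A] colours. *)
  pose d x := if x == a then None else Some (c x).
  exists (canonical A d); apply/and3P; split.
  - apply/proper_canonical/proper_onP => x y xA yA xy; rewrite /d.
    case: (eqVneq x a) xy => [->|nx] xy; case: (eqVneq y a) xy => [->|ny] xy //.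
      by rewrite adj_irr in xy.
    by rewrite (inj_eq (@Some_inj _)); apply: cA => //; rewrite !inE ?nx ?ny.
  - rewrite card_canonical; apply: leq_trans crit; rewrite -cchi.
    rewrite -(card_imset (c @: _) (@Some_inj _)).
    apply: leq_trans (_ : #|None |: Some @: (c @: (A :\ a))| <= _); last first.
      by rewrite cardsU1; case: (_ \notin _); rewrite ?leqnSn.
    apply/subset_leq_card/subsetP => _ /imsetP[x xA ->]; rewrite /d !inE.
    by case: (eqVneq x a) => //= nx; rewrite !imset_f // !inE nx.
  - apply/singletonsP; split=> // y yA /eqP; rewrite canonical_eq // /d eqxx.
    by case: (eqVneq y a).
case: (@arg_maxnP _ Q0 good (fun Q => #|mono Q|) gQ0) => Q gQ maxQ.
have /and3P[QA Qchi Qa] := gQ.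
exists Q; split => //; apply/subsetP => w wQ; rewrite in_setU1.
case: (eqVneq w a) => //= nwa; apply/negPn/negP => wP.
have /singletonsP[wA sw] := wQ.
have [y yA [Pyw nyw]] := singletonsPn wA wP.
(* [a] and [w] are singletons of the optimal [Q], hence adjacent. So [a] lies outside the [P]-class
   of [w] and stays a singleton after the recolouring [Q']. *)
have Paw : P a != P w.
  by apply: PA => //; apply: (singletons_adj QA); rewrite // eq_sym.
pose Q' := [ffun v => if P v == P w then Q w else Q v].
have gQ' : good Q'.
  move: QA Qa => /proper_onP QA /singletonsP[_ sa].
  apply/and3P; split.
  - apply/proper_onP => u v uA vA uv; rewrite !ffunE.
    case: (eqVneq (P u) (P w)) => [Pu|nPu]; case: (eqVneq (P v) (P w)) => [Pv|nPv].
    + by have := PA u v uA vA uv; rewrite Pu Pv eqxx.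
    + by apply: contraNneq nPv => /esym /(sw v vA) ->.
    + by apply: contraNneq nPu => /(sw u uA) ->.
    + exact: QA.
  - apply: leq_trans Qchi; apply/subset_leq_card/subsetP => _ /imsetP[v vA ->].
    by rewrite ffunE; case: ifP => _; apply: imset_f.
  - apply/singletonsP; split=> // v vA; rewrite !ffunE (negbTE Paw).
    by case: ifP => [_ /(sa w wA) e|_ /(sa v vA)//]; rewrite e eqxx in nwa.
have : #|mono Q'| <= #|mono Q| by apply: maxQ.
rewrite leqNgt => /negP; apply; apply/proper_card/properP.
split.
  apply/subsetP => -[u v]; rewrite !inE /= => /and4P[-> -> /eqP Puv /eqP Quv].
  by rewrite !ffunE Puv Quv !eqxx.
(* This pair is new: [w] was alone in its [Q]-class. *)
exists (y, w); rewrite !inE /= yA wA Pyw !eqxx /= ?ffunE ?Pyw ?eqxx //=.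
by apply: contra nyw => /eqP /(sw y yA) ->.
Qed.

(* For [P] with the fewest singletons and [y] one of them, the vertices that share an optimal, singleton-minimal colouring with [y], both as singletons, are joined to all the others. *)
Lemma critical_join A : #|A| + 2 <= (chi A).*2 ->
  (forall a, a \in A -> chi (A :\ a) < chi A) ->
  exists B C, [/\ A = B :|: C, [disjoint B & C], B != set0, C != set0 &
    {in B & C, forall x y, adj x y}].
Proof.
move=> hA crit.
pose opt (c : {ffun G -> G}) := proper_on A c && (#|c @: A| <= chi A).
have [c0 c0A c0chi] := chiP A.
have o0 : opt c0 by rewrite /opt c0A c0chi /=.
case: (@arg_minnP _ c0 opt (fun c => #|singletons A c|) o0) => P /andP[PA Pchi] minP.
set s := #|singletons A P| in minP.
(* From [card_singletons]: twice the number of colours is at most [#|A| + s], while it is at least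
   [#|A| + 2]. *)
have s2 : 1 < s.
  have := card_singletons A P; have := chi_le PA.
  by rewrite -/s; lia.
have [y [x [yP xP nyx]]] : exists y x,
    [/\ y \in singletons A P, x \in singletons A P & y != x].
  by case/card_gt1P: s2 => y [x [? ? ?]]; exists y, x.
have yA : y \in A by case/singletonsP: yP.
pose Y := [set v in A | (v != y) && [exists c, [&& opt c,
   #|singletons A c| <= s, v \in singletons A c & y \in singletons A c]]].
have YA : Y \subset A by apply/subsetP => v; rewrite inE => /andP[].
exists Y, (A :\: Y); split.
- by rewrite -{1}(setID A Y) (setIidPr YA).
- by rewrite disjoint_sym disjoints_subset setDE subsetIr.
- apply/set0Pn; exists x; rewrite inE eq_sym nyx; apply/andP; split.
    by case/singletonsP: xP.
  by apply/existsP; exists P; rewrite /opt PA Pchi xP yP leqnn.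
- by apply/set0Pn; exists y; rewrite !inE yA eqxx.
move=> {nyx xP}x a xY; have := xY; rewrite inE.
case/and3P=> xA nxy /existsP[c /and4P[oc cs xc yc]].
rewrite in_setD => /andP[aY aA]; apply/negPn/negP => nadj.
have /andP[cA cchi] := oc.
have nay : a != y.
  by apply: contraNneq nadj => ->; apply: (singletons_adj cA).
have nxa : x != a by apply: contraNneq aY => <-.
(* The transfer is applied to [c], not to [P]: the only possible new singleton is [a], and [x] stops
   being one because it is not adjacent to [a]. *)
have [Q [QA Qchi Qa Qsub]] := transfer_singletons cA aA (crit a aA).
have oQ : opt Q by apply/andP.
have Qx : x \notin singletons A Q.
  by apply: contra nadj => Qx; apply: (singletons_adj QA).
have cx : #|singletons A c :\ x| < s.
  by move: cs; rewrite (cardsD1 x) xc.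
(* If [y] is still a singleton, exchanging [x] for [a] keeps the count at most [s], so [Q] witnesses
   that [a] is in [Y]. Otherwise both [x] and [y] are lost and only [a] can be gained, against the
   minimality of [s]. *)
case: (boolP (y \in singletons A Q)) => Qy.
  case/negP: aY; rewrite inE aA nay; apply/existsP; exists Q.
  rewrite oQ Qa Qy /= andbT; apply: leq_trans cx.
  apply: leq_trans (_ : #|a |: (singletons A c :\ x)| <= _).
    apply/subset_leq_card/subsetP => v vQ; have := subsetP Qsub v vQ.
    rewrite !inE => /orP[->//|->]; rewrite andbT orbC.
    by have -> : v != x by apply: contraNneq Qx => <-.
  by rewrite cardsU1; case: (_ \notin _).
have : s <= #|singletons A Q| by apply: minP.
rewrite leqNgt => /negP; apply.
have yx : y \in singletons A c :\ x by rewrite in_setD1 eq_sym nxy.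
apply: leq_trans cx; rewrite (cardsD1 y (_ :\ x)) yx ltnS.
apply: leq_trans (_ : #|a |: (singletons A c :\ x :\ y)| <= _).
  apply/subset_leq_card/subsetP => v vQ; have := subsetP Qsub v vQ.
  rewrite !in_setU1 !in_setD1 => /orP[->//|->].
  have -> : v != x by apply: contraNneq Qx => <-.
  by have -> : v != y; [apply: contraNneq Qy => <-|rewrite orbT].
by rewrite cardsU1; case: (_ \notin _).
Qed.

(** * Clique number and maximum degree of induced subgraphs and of joins *)

Definition omega A : nat := \max_(K : {set G} | (K \subset A) && clique K) #|K|.

Definition Delta A : nat := \max_(x in A) #|[set y in A | adj x y]|.

Lemma leq_omega A K : K \subset A -> clique K -> #|K| <= omega A.
Proof. by move=> KA cK; apply: (@leq_bigmax_cond _ _ (fun K : {set G} => #|K|)); rewrite KA. Qed.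

Lemma omegaP A : exists K, [/\ K \subset A, clique K & #|K| = omega A].
Proof.
have h0 : (set0 \subset A) && clique (set0 : {set G}).
  by rewrite sub0set; apply/cliqueP => x y; rewrite inE.
have [|K /andP[KA cK] e] :=
  @eq_bigmax_cond _ [pred K : {set G} | (K \subset A) && clique K] (fun K => #|K|).
  by apply/card_gt0P; exists set0.
by exists K; split=> //; rewrite -e.
Qed.

Lemma leq_Delta A x : x \in A -> #|[set y in A | adj x y]| <= Delta A.
Proof. exact: (@leq_bigmax_cond _ _ (fun x => #|[set y in A | adj x y]|)). Qed.

Lemma DeltaP A : A != set0 -> exists2 x, x \in A & #|[set y in A | adj x y]| = Delta A.
Proof.
move=> /set0Pn[x0 x0A].
have [|x xA e] := @eq_bigmax_cond _ (mem A) (fun x => #|[set y in A | adj x y]|).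
  by apply/card_gt0P; exists x0.
by exists x.
Qed.

Lemma omega_sub A B : B \subset A -> omega B <= omega A.
Proof.
by move=> BA; have [K [KB cK <-]] := omegaP B; apply: leq_omega => //; apply: subset_trans BA.
Qed.

Lemma Delta_sub A B : B \subset A -> Delta B <= Delta A.
Proof.
move=> BA; apply/bigmax_leqP => x xB; apply: leq_trans (leq_Delta (subsetP BA x xB)).
apply/subset_leq_card/subsetP => y; rewrite !inE => /andP[yB ->].
by rewrite (subsetP BA).
Qed.

Lemma omega_gt0 A : A != set0 -> 0 < omega A.
Proof.
case/set0Pn => x xA; rewrite -(cards1 x); apply: leq_omega; first by rewrite sub1set.
by apply/cliqueP => u v /set1P-> /set1P->; rewrite eqxx.
Qed.

Lemma omega_le1 A : omega A <= 1 -> independent A.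
Proof.
move=> A1; apply/independentP => x y xA yA; apply/negP => xy.
have nxy : x != y by apply: contraTneq xy => ->; rewrite adj_irr.
suff /leq_trans /(_ A1) : #|[set x; y]| <= omega A by rewrite cards2 nxy.
apply: leq_omega; first by rewrite subUset !sub1set xA.
apply/cliqueP => u v; rewrite !inE => /orP[] /eqP-> /orP[] /eqP->; rewrite ?eqxx //.
by rewrite adj_sym.
Qed.

Lemma omega_join B C : [disjoint B & C] -> {in B & C, forall x y, adj x y} ->
  omega B + omega C <= omega (B :|: C).
Proof.
move=> dBC aBC; have [K [KB /cliqueP cK <-]] := omegaP B.
have [L [LC /cliqueP cL <-]] := omegaP C.
have dKL : [disjoint K & L] by apply: disjointWl KB _; apply: disjointWr LC _.
rewrite -cardsUI (disjoint_setI0 dKL) cards0 addn0.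
apply: leq_omega; first exact: setUSS.
have aKL x y : x \in K -> y \in L -> adj x y.
  by move=> /(subsetP KB) xB /(subsetP LC); apply: aBC.
apply/cliqueP => x y; rewrite !inE => /orP[xK|xL] /orP[yK|yL] nxy.
- exact: cK.
- exact: aKL.
- by rewrite adj_sym aKL.
- exact: cL.
Qed.

Lemma Delta_join B C : [disjoint B & C] -> {in B & C, forall x y, adj x y} ->
  B != set0 -> Delta B + #|C| <= Delta (B :|: C).
Proof.
move=> dBC aBC /DeltaP[x xB <-].
have xBC : x \in B :|: C by rewrite inE xB.
apply: leq_trans (leq_Delta xBC).
have d : [disjoint [set y in B | adj x y] & C].
  by apply: disjointWl dBC; apply/subsetP => y; rewrite inE => /andP[].
rewrite -cardsUI (disjoint_setI0 d) cards0 addn0.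
apply/subset_leq_card/subsetP => y; rewrite !inE => /orP[/andP[-> ->]//|yC].
by rewrite yC orbT aBC.
Qed.

(* Removing non-critical vertices only increases [(chi A).*2 - #|A|]. *)
Lemma critical_ind (p : {set G} -> Prop) :
  (forall A a, a \in A -> chi A <= chi (A :\ a) -> p (A :\ a) -> p A) ->
  (forall A, (forall a, a \in A -> chi (A :\ a) < chi A) ->
     (forall B, B \proper A -> p B) -> p A) ->
  forall A, p A.
Proof.
move=> h1 h2 A; have [n] := ubnP #|A|; elim: n A => // n IH A An.
have IHA B : B \proper A -> p B.
  by move=> /proper_card BA; apply: IH; lia.
case: (boolP [exists a in A, chi A <= chi (A :\ a)]) => [/exists_inP[a aA ha]|].
  by apply: (h1 A a) => //; apply/IHA/properD1.
by move/exists_inPn => h; apply: h2 => // a aA; rewrite ltnNge h.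
Qed.

(** * Upper bounds on twice the chromatic number *)

(** A critical set either satisfies [(chi A).*2 <= #|A| + 1], where [omega A >= 1] is enough, or is
    a join, where [chi] is subadditive and [omega] superadditive. *)
Lemma double_chi_le A : (chi A).*2 <= omega A + #|A|.
Proof.
elim/critical_ind: A => [A a aA ha IH|A crit IH].
  by have := omega_sub (subD1set A a); rewrite (cardsD1 a A) aA; lia.
case: (leqP (#|A| + 2) (chi A).*2) => [hA|]; last first.
  have [->|A0] := eqVneq A set0; first by rewrite chi0.
  by have := omega_gt0 A0; lia.
have [B [C [eA dBC B0 C0 aBC]]] := critical_join hA crit.
have cA : #|A| = #|B| + #|C|.
  by rewrite eA -cardsUI (disjoint_setI0 dBC) cards0 addn0.
have [cB cC] : 0 < #|B| /\ 0 < #|C| by rewrite !card_gt0.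
have /IH hB : B \proper A by rewrite properEcard eA subsetUl -eA; lia.
have /IH hC : C \proper A by rewrite properEcard eA subsetUr -eA; lia.
have := omega_join dBC aBC; have := chiU B C; rewrite -eA; lia.
Qed.

(** By maximality each vertex of [A :\: I] has a neighbour in [I], so [Delta] drops by at least 1,
    while [chi] drops by at most 1. The last hypothesis is the sharper bound for what remains. *)
Lemma remove_maximum_independent A I : I \subset A -> independent I ->
  (forall J : {set G}, J \subset A -> independent J -> #|J| <= #|I|) ->
  #|A| + 4 <= (chi A).*2 + #|I| ->
  (#|A :\: I| + 2 <= (chi (A :\: I)).*2 ->
     (chi (A :\: I)).*2 <= omega (A :\: I) + Delta (A :\: I) + 1) ->
  (chi A).*2 <= omega A + Delta A + 2.
Proof.
move=> IA iI maxI hA star.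
have cA : #|A| = #|A :\: I| + #|I|.
  by rewrite -(cardsID I A) (setIidPr IA) addnC.
have chiA : chi A <= chi (A :\: I) + 1.
  rewrite -{1}(setID A I) (setIidPr IA) setUC.
  by apply: leq_trans (chiU _ _) _; rewrite leq_add2l chi_independent.
have /star {}star : #|A :\: I| + 2 <= (chi (A :\: I)).*2 by lia.
have D0 : A :\: I != set0.
  by apply: contraTneq hA => e; move: chiA cA; rewrite e chi0 cards0; lia.
have dle : Delta (A :\: I) < Delta A.
  have [x xD <-] := DeltaP D0; have := xD; rewrite inE => /andP[xI xA].
  apply: leq_trans (leq_Delta xA).
  have [z zI xz] : exists2 z, z \in I & adj x z.
    apply/exists_inP; apply: contraT => /exists_inPn h.
    have := maxI (x |: I); rewrite subUset sub1set xA IA cardsU1 xI ltnn => ->//.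
    move/independentP: iI => iI.
    apply/independentP => u v; rewrite !inE => /orP[/eqP->|uI] /orP[/eqP->|vI].
    - by rewrite adj_irr.
    - exact: h.
    - by rewrite adj_sym h.
    - exact: iI.
  apply/proper_card/properP; split.
    by apply/subsetP => y; rewrite !inE => /andP[/andP[_ ->] ->].
  by exists z; rewrite !inE ?zI // xz (subsetP IA).
have := omega_sub (subsetDl A I); lia.
Qed.

Lemma maximum_independent A : exists I, [/\ I \subset A, independent I &
  forall J : {set G}, J \subset A -> independent J -> #|J| <= #|I|].
Proof.
have h0 : (set0 \subset A) && independent (set0 : {set G}).
  by rewrite sub0set; apply/independentP => x y; rewrite inE.
case: (@arg_maxnP _ set0 (fun J : {set G} => (J \subset A) && independent J)
  (fun J => #|J|) h0) => I /andP[IA iI] maxI.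
by exists I; split=> // J JA iJ; apply: maxI; rewrite JA.
Qed.

(** Two non-adjacent non-neighbours of [x] would form with [x] an independent set of size 3. So [A]
    consists of [x], its neighbours and a clique. *)
Lemma independence_le2 A x :
  (forall J : {set G}, J \subset A -> independent J -> #|J| <= 2) ->
  x \in A -> #|A| <= omega A + Delta A + 1.
Proof.
move=> a2 xA; set N := [set y in A | ~~ adj x y] :\ x.
have NA : N \subset A by apply/subsetP => y; rewrite !inE => /and3P[].
have cN : clique N.
  apply/cliqueP => u v; rewrite !inE => /and3P[nux uA xu] /and3P[nvx vA xv] nuv.
  apply/negPn/negP => uv.
  have : #|[set x; u; v]| <= 2.
    apply: a2; first by rewrite !subUset !sub1set xA uA vA.
    apply/independentP => s t; rewrite !inE => /orP[/orP[]|] /eqP-> /orP[/orP[]|] /eqP->;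
      by rewrite ?adj_irr // adj_sym.
  by rewrite setUC cardsU1 cards2 !inE (negbTE nvx) (eq_sym v u) (negbTE nuv) (eq_sym x u) nux.
have cA : #|A| <= #|[set y in A | adj x y]| + #|N| + 1.
  rewrite -(cardsID [set y | adj x y] A) -addnA leq_add //.
    by apply/subset_leq_card/subsetP => y; rewrite !inE.
  apply: leq_trans (_ : #|x |: N| <= _); last by rewrite cardsU1; case: (_ \notin _); lia.
  by apply/subset_leq_card/subsetP => y; rewrite !inE; case: eqVneq => //= _; rewrite andbC.
have := leq_omega NA cN; have := leq_Delta xA; lia.
Qed.

Lemma double_chi_le_Delta A :
  #|A| + 2 <= (chi A).*2 -> (chi A).*2 <= omega A + Delta A + 1.
Proof.
elim/critical_ind: A => [A a aA ha IH hA|A crit IH hA].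
  have := cardsD1 a A; rewrite aA => cA.
  have := omega_sub (subD1set A a); have := Delta_sub (subD1set A a); lia.
have [B [C [eA dBC B0 C0 aBC]]] := critical_join hA crit.
have cA : #|A| = #|B| + #|C|.
  by rewrite eA -cardsUI (disjoint_setI0 dBC) cards0 addn0.
have [cB cC] : 0 < #|B| /\ 0 < #|C| by rewrite !card_gt0.
have BA : B \proper A by rewrite properEcard eA subsetUl -eA; lia.
have CA : C \proper A by rewrite properEcard eA subsetUr -eA; lia.
have oA := omega_join dBC aBC; have DB := Delta_join dBC aBC B0.
have DC : Delta C + #|B| <= Delta (B :|: C).
  rewrite setUC; apply: Delta_join => //; first by rewrite disjoint_sym.
  by move=> x y xC yB; rewrite adj_sym aBC.
have chiA := chiU B C; rewrite -eA in oA DB DC chiA.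
have hB := double_chi_le B; have hC := double_chi_le C.
have starB := IH B BA; have starC := IH C CA.
(* When [#|I| >= 3], the value [#|B| + 1] of [(chi B).*2] is just enough for the size condition of
   [remove_maximum_independent]. *)
have reedB : (chi B).*2 = #|B| + 1 -> (chi B).*2 <= omega B + Delta B + 2.
  move=> eB; have [I [IB iI maxI]] := maximum_independent B.
  case: (leqP #|I| 2) => I2.
    have /set0Pn[x xB] := B0.
    have := @independence_le2 B x _ xB; rewrite eB => h.
    have /h : forall J : {set G}, J \subset B -> independent J -> #|J| <= 2.
      by move=> J JB iJ; apply: leq_trans (maxI J JB iJ) I2.
    lia.
  apply: (remove_maximum_independent IB iI maxI); first by lia.
  by apply: IH; apply: sub_proper_trans (subsetDl _ _) BA.
have chiC1 : omega C <= 1 -> chi C <= 1 by move/omega_le1/chi_independent.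
(* If neither [starB] nor [starC] applies, [hA] forces [(chi B).*2 = #|B| + 1] and likewise for [C].
   If [omega C >= 2], [reedB] and [DB] conclude. If [omega C = 1], then [chi C = 1] and [#|C| = 1],
   so [DC] gives [#|B| <= Delta A], and [omega A >= 2] closes the gap. *)
have := omega_gt0 C0; lia.
Qed.

(** * Transfer to the whole graph and to the rational statement *)

(** Numbering the colours used by an optimal [c] gives a colouring in ordinals. This direction
    serves both the lower bound assumed on the chromatic number and the upper bound to be proved. *)
Lemma chromatic_number_le : chromatic_number G <= chi [set: G].
Proof.
have [c /proper_onP cG <-] := chiP [set: G].
rewrite /chromatic_number; case: ex_minnP => m _; apply.
apply/existsP; exists [ffun x => enum_rank_in (imset_f c (in_setT x)) (c x)].
apply/forallP => x; apply/forallP => y; apply/implyP => xy; rewrite !ffunE.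
apply: contraNneq (cG x y (in_setT x) (in_setT y) xy) => e.
rewrite -(enum_rankK_in (imset_f c (in_setT x)) (imset_f c (in_setT x))) e.
by rewrite enum_rankK_in // imset_f.
Qed.

Lemma omega_setT : omega [set: G] = clique_number G.
Proof. by apply: eq_bigl => K; rewrite subsetT. Qed.

Lemma Delta_setT : Delta [set: G] = max_degree G.
Proof.
apply: eq_big => [x|x _]; first by rewrite inE.
by apply: eq_card => y; rewrite !inE.
Qed.

Lemma reed_independence :
  #|G| + 4 <= (chromatic_number G).*2 + independence_number G ->
  (chromatic_number G).*2 <= clique_number G + max_degree G + 2.
Proof.
move=> h; have chiG := chromatic_number_le.
have [I [IG iI maxI]] := maximum_independent [set: G].
have alphaI : independence_number G <= #|I|.
  by apply/bigmax_leqP => J; apply: maxI; apply: subsetT.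
have := remove_maximum_independent IG iI maxI _ (@double_chi_le_Delta _).
rewrite omega_setT Delta_setT cardsT; lia.
Qed.

End Coloring.

Local Open Scope ring_scope.

Theorem theorem4p3 (G : sgraph)
    (hchi : (#|G|%:R + 3 - (independence_number G)%:R) / 2
              < (chromatic_number G)%:R :> rat) :
  (chromatic_number G)%:Z
    <= Num.ceil (((clique_number G)%:R + (max_degree G)%:R + 1) / 2 : rat).
Proof.
(* The strict inequality between integers turns the 3 of the hypothesis into 4. *)
have /reed_independence : (#|G| + 4 <= (chromatic_number G).*2 + independence_number G)%N.
  have : #|G|%:R + 3%:R < (chromatic_number G).*2%:R + (independence_number G)%:R :> rat.
    by rewrite -mul2n natrM; lra.
  by rewrite -!natrD ltr_nat; lia.
rewrite -(ler_nat rat) -mul2n natrM !natrD => h.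
(* An integer is below a ceiling iff it is below the number itself, so the claim becomes
   [2 chi < omega + Delta + 3]; rounding up accounts for the 2 in [reed_independence]. *)
suff : (chromatic_number G)%:Z - 1 < Num.ceil
    (((clique_number G)%:R + (max_degree G)%:R + 1) / 2 : rat) by lia.
by rewrite Num.Theory.ceil_gt_int rmorphB /=; lra.
Qed.
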